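(* Let $X$ be a finite psyquandle and let $L$ be an oriented singular link diagram (respectively, let $X$ be a finite pI-adequate psyquandle and let $L$ be an oriented pseudolink diagram). Then the number of $X$-colorings of $L$ is not changed by the Reidemeister moves for oriented singular links (respectively, for oriented pseudolinks). Hence this number defines an invariant $\Phi_X^{\mathbb{Z}}(L)$ of oriented singular links (respectively, of oriented pseudolinks), called the psyquandle counting invariant.
   Context: **Biquandles.** A biquandle is a set $X$ with operations $\underline{\triangleright},\overline{\triangleright}:X\times X\to X$ such that (i) $x\,\underline{\triangleright}\,x=x\,\overline{\triangleright}\,x$ for all $x$; (ii) for all $y\in X$ the maps $\alpha_y(x)=x\,\overline{\triangleright}\,y$ and $\beta_y(x)=x\,\underline{\triangleright}\,y$ from $X$ to $X$ are invertible, and the map $S:X\times X\to X\times X$, $S(x,y)=(y\,\overline{\triangleright}\,x,\;x\,\underline{\triangleright}\,y)$, is invertible; (iii) for all $x,y,z$: $(x\underline{\triangleright}y)\underline{\triangleright}(z\underline{\triangleright}y)=(x\underline{\triangleright}z)\underline{\triangleright}(y\overline{\triangleright}z)$, $(x\underline{\triangleright}y)\overline{\triangleright}(z\underline{\triangleright}y)=(x\overline{\triangleright}z)\underline{\triangleright}(y\overline{\triangleright}z)$, $(x\overline{\triangleright}y)\overline{\triangleright}(z\overline{\triangleright}y)=(x\overline{\triangleright}z)\overline{\triangleright}(y\underline{\triangleright}z)$. **Psyquandles.** A psyquandle is a biquandle $X$ with two more operations $\underline{\bullet},\overline{\bullet}:X\times X\to X$ such that (p/si) for all $y\in X$ the maps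 $\alpha'_y(x)=x\,\overline{\bullet}\,y$ and $\beta'_y(x)=x\,\underline{\bullet}\,y$ are invertible, and $S'(x,y)=(y\,\overline{\bullet}\,x,\;x\,\underline{\bullet}\,y)$ is an invertible map $X\times X\to X\times X$; (p/sii) for all $x,y\in X$ there exist unique $w,z\in X$ with $x\underline{\triangleright}y=z\overline{\bullet}y$, $y\overline{\triangleright}x=w\overline{\bullet}x$, $w\underline{\triangleright}z=y\underline{\bullet}z$, $z\overline{\triangleright}w=x\underline{\bullet}w$; (p/siii) for all $x,y,z\in X$: $(x\overline{\triangleright}y)\overline{\triangleright}(z\overline{\bullet}y)=(x\overline{\triangleright}z)\overline{\triangleright}(y\underline{\bullet}z)$, $(x\underline{\triangleright}y)\underline{\triangleright}(z\overline{\bullet}y)=(x\underline{\triangleright}z)\underline{\triangleright}(y\underline{\bullet}z)$, $(x\overline{\triangleright}y)\overline{\bullet}(z\overline{\triangleright}y)=(x\overline{\bullet}z)\overline{\triangleright}(y\underline{\triangleright}z)$, $(x\underline{\triangleright}y)\underline{\bullet}(z\underline{\triangleright}y)=(x\underline{\bullet}z)\underline{\triangleright}(y\overline{\triangleright}z)$, $(x\overline{\triangleright}y)\underline{\bullet}(z\overline{\triangleright}y)=(x\underline{\bullet}z)\overline{\triangleright}(y\underline{\triangleright}z)$, $(x\underline{\triangleright}y)\overline{\bullet}(z\underline{\triangleright}y)=(x\overline{\bullet}z)\underline{\triangleright}(y\overline{\triangleright}z)$. It is pI-adequate if moreover $x\,\underline{\bullet}\,x=x\,\overline{\bullet}\,x$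 for all $x\in X$. **Diagrams and moves.** An oriented singular link diagram (resp. oriented pseudolink diagram) is an oriented link diagram in which, besides classical crossings, there may be singular crossings (resp. precrossings): transverse self-intersections with no over/under information, through which both oriented strands pass. Oriented singular links are equivalence classes of diagrams under planar isotopy and the following Reidemeister moves: the oriented classical Reidemeister moves I, II, III; the move p/sII, which says that, for two parallel strands both oriented upward, a singular crossing followed by a classical crossing of the two strands may be replaced by a classical crossing of the same sign followed by a singular crossing; and the moves p/sIII and p/sIII$'$, in which a strand is moved, respectively, over or under a singular crossing (crossing it with classical crossings only) from one side to the other. Oriented pseudolinks are equivalence classes of diagrams under the same moves with precrossings in place of singular crossings, together with the move pI: adding or removing a kink (a Reidemeister I type loop) whose only crossing is a precrossing. **Colorings.** The semiarcs of a diagram are the edges of the graph obtained by regarding every crossing (classical, singular or precrossing) as a 4-valent vertex (a crossingless closed component counts as one semiarc). An $X$-coloring is an assignment of elements of $X$ to the semiarcs such that the following holds at every crossing. Draw the crossing with both strands oriented upward, with ends bottom-left (BL), bottom-right (BR), top-left (TL), top-right (TR), so the strands run BL$\to$TR and BR$\to$TL. Write $x$ for the color of BR and $y$ for the color of TR. Then: - positive crossing (the strand BL$\to$TR is the over strand): TL has color $x\,\underline{\triangleright}\,y$ and BL has color $y\,\overline{\triangleright}\,x$; - negative crossing (the strand BR$\to$TL is the over strand): TL has color $x\,\overline{\triangleright}\,y$ and BL has color $y\,\underline{\triangleright}\,x$; - singular crossing or precrossing: TL has color $x\,\underline{\bullet}\,y$ and BL has color $y\,\overline{\bullet}\,x$.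 *)

(* Defs.v *)
From HB Require Import structures.
From mathcomp Require Import all_boot.
From mathcomp Require Import generic_quotient boolp.

Set Implicit Arguments.
Unset Strict Implicit.
Unset Printing Implicit Defensive.

Local Open Scope quotient_scope.

(* [ut], [ot], [ud], [od] stand for the underlined and overlined triangle
   and the underlined and overlined dot, in that order. *)

Record is_biquandle (X : Type) (ut ot : X -> X -> X) : Prop := IsBiquandle {
  biq_diag : forall x, ut x x = ot x x;
  biq_ot_bij : forall y, bijective (fun x => ot x y);
  biq_ut_bij : forall y, bijective (fun x => ut x y);
  biq_S_bij : bijective (fun p : X * X => (ot p.2 p.1, ut p.1 p.2));
  biq_uu : forall x y z,
    ut (ut x y) (ut z y) = ut (ut x z) (ot y z);
  biq_uo : forall x y z,
    ot (ut x y) (ut z y) = ut (ot x z) (ot y z);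
  biq_oo : forall x y z,
    ot (ot x y) (ot z y) = ot (ot x z) (ut y z)
}.

Record is_psyquandle (X : Type) (ut ot ud od : X -> X -> X) : Prop :=
IsPsyquandle {
  psy_biquandle : is_biquandle ut ot;
  psy_od_bij : forall y, bijective (fun x => od x y);
  psy_ud_bij : forall y, bijective (fun x => ud x y);
  psy_S'_bij : bijective (fun p : X * X => (od p.2 p.1, ud p.1 p.2));
  psy_ii : forall x y, exists! wz : X * X,
    let: (w, z) := wz in
    [/\ ut x y = od z y, ot y x = od w x,
        ut w z = ud y z & ot z w = ud x w];
  psy_iii1 : forall x y z,
    ot (ot x y) (od z y) = ot (ot x z) (ud y z);
  psy_iii2 : forall x y z,
    ut (ut x y) (od z y) = ut (ut x z) (ud y z);
  psy_iii3 : forall x y z,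
    od (ot x y) (ot z y) = ot (od x z) (ut y z);
  psy_iii4 : forall x y z,
    ud (ut x y) (ut z y) = ut (ud x z) (ot y z);
  psy_iii5 : forall x y z,
    ud (ot x y) (ot z y) = ot (ud x z) (ut y z);
  psy_iii6 : forall x y z,
    od (ut x y) (ut z y) = ut (od x z) (ot y z)
}.

Record psyquandle (X : Type) := Psyquandle {
  utri : X -> X -> X;
  otri : X -> X -> X;
  udot : X -> X -> X;
  odot : X -> X -> X;
  psyquandleP : is_psyquandle utri otri udot odot
}.

Definition pI_adequate (X : Type) (Q : psyquandle X) : Prop :=
  forall x : X, udot Q x x = odot Q x x.

(* A [flat] crossing carries no over/under information: it is a singular
   crossing of a singular link diagram, or a precrossing of a pseudolink
   diagram. *)
Inductive kind := pos | neg | flat.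

Definition kind_code (k : kind) : option bool :=
  match k with pos => Some true | neg => Some false | flat => None end.
Definition kind_decode (o : option bool) : kind :=
  match o with Some true => pos | Some false => neg | None => flat end.
Lemma kind_codeK : cancel kind_code kind_decode. Proof. by case. Qed.
HB.instance Definition _ := Countable.copy kind (can_type kind_codeK).

Definition opp_kind (k : kind) : kind :=
  match k with pos => neg | neg => pos | flat => flat end.

(* A crossing drawn with both strands oriented upward, together with the
   labels of the semiarcs at its four ends; the strands run from [bl] to [tr]
   and from [br] to [tl]. *)
Record crossing := Crossing {
  ckind : kind; bl : nat; br : nat; tl : nat; tr : nat
}.

Definition crossing_code (c : crossing) :=
  (ckind c, (bl c, br c), (tl c, tr c)).
Definition crossing_decode (p : kind * (nat * nat) * (nat * nat)) :=
  let: (k, (a, b), (c, d)) := p in Crossing k a b c d.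
Lemma crossing_codeK : cancel crossing_code crossing_decode.
Proof. by case. Qed.
HB.instance Definition _ := Countable.copy crossing (can_type crossing_codeK).

(* A planar diagram code: the list of the crossings, and the list of the
   labels of the crossingless closed components. *)
Definition code : Type := (seq crossing * seq nat)%type.

Definition in_labels (xs : seq crossing) : seq nat :=
  flatten [seq [:: bl c; br c] | c <- xs].
Definition out_labels (xs : seq crossing) : seq nat :=
  flatten [seq [:: tl c; tr c] | c <- xs].

Definition labels (D : code) : seq nat := in_labels D.1 ++ D.2.

(* Each semiarc is either a crossingless closed component, or leaves exactly
   one crossing end and enters exactly one crossing end. *)
Definition well_formed (D : code) : bool :=
  uniq (labels D) && perm_eq (in_labels D.1) (out_labels D.1).

(* The crossing ends of a code; the ends of each crossing are numbered
   counterclockwise. *)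
Definition cend (xs : seq crossing) : finType := ('I_(size xs) * 'I_4)%type.
Definition cend_label (xs : seq crossing) (d : cend xs) : nat :=
  let c := tnth (in_tuple xs) d.1 in
  nth 0 [:: bl c; br c; tr c; tl c] d.2.

(* Follow the semiarc at [d] to its other end [e], then turn to the next end
   around the crossing of [e]: the orbits are the faces of the surface obtained
   by capping off the ribbon graph of the diagram. *)
Definition face_step (xs : seq crossing) : rel (cend xs) := fun d d' =>
  [exists e : cend xs,
    [&& e != d, cend_label e == cend_label d & d' == (e.1, ordS e.2)]].
Definition nfaces (xs : seq crossing) : nat :=
  n_comp (fun d d' : cend xs => face_step d d' || face_step d' d) predT.

Definition adjacent (xs : seq crossing) : rel 'I_(size xs) := fun i j =>
  [exists k : 'I_4, exists l : 'I_4,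
    cend_label ((i, k) : cend xs) == cend_label ((j, l) : cend xs)].
Definition ncomponents (xs : seq crossing) : nat := n_comp (@adjacent xs) predT.

(* Euler's formula V - E + F = 2 C, where V = size xs and E = 2 V: every
   connected component of the underlying graph lies on a sphere. *)
Definition planar (D : code) : bool :=
  nfaces D.1 == size D.1 + (ncomponents D.1).*2.

Record diagram := Diagram {
  dcode :> code;
  _ : well_formed dcode && planar dcode
}.
HB.instance Definition _ := [isSub for dcode].
HB.instance Definition _ := [Choice of diagram by <:].

Definition relabel_crossing (f : nat -> nat) (c : crossing) : crossing :=
  Crossing (ckind c) (f (bl c)) (f (br c)) (f (tl c)) (f (tr c)).
Definition relabel (f : nat -> nat) (D : code) : code :=
  (map (relabel_crossing f) D.1, map f D.2).

(* A code determines the embedding of each connected component of the diagram,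
   so planar isotopic diagrams have codes that differ only by the naming of the
   semiarcs and the listing order. The unbounded face and the relative position
   of the connected components are not recorded; the moves can change them. *)
Definition isotopic (D D' : code) : Prop :=
  exists f : nat -> nat,
    [/\ injective f, perm_eq (relabel f D).1 D'.1
      & perm_eq (relabel f D).2 D'.2].

(* A piece of diagram in a disk: its crossings, and its crossingless strands
   [(a, b)], entering the disk as [a] and leaving it as [b]. *)
Definition tangle : Type := (seq crossing * seq (nat * nat))%type.

Definition rename (b a x : nat) : nat := if x == b then a else x.

(* Merge the labels at the two ends of each strand; a strand both ends of which
   already have the same label closes up into a crossingless component. The
   accumulator [f] is the renaming performed by the previous merges. *)
Fixpoint splice (f : nat -> nat) (js : seq (nat * nat)) (D : code) : code :=
  match js with
  | [::] => D
  | (a, b) :: js' =>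
      if f a == f b then splice f js' (D.1, f a :: D.2)
      else splice (rename (f b) (f a) \o f) js'
                  (relabel (rename (f b) (f a)) D)
  end.

Definition plug (T : tangle) (K : code) : code :=
  splice id T.2 (T.1 ++ K.1, K.2).

(* A classical crossing of a strand [ti -> to] with a strand [si -> so]: the
   former passes over the latter iff [over], and passes from its left to its
   right (resp. from its right to its left). *)
Definition cross_lr (over : bool) (ti to si so : nat) : crossing :=
  Crossing (if over then pos else neg) ti si so to.
Definition cross_rl (over : bool) (ti to si so : nat) : crossing :=
  Crossing (if over then neg else pos) si ti to so.

Inductive kink (k : kind) : tangle -> tangle -> Prop :=
| kink_right a b l :
    kink k ([:: Crossing k a l b l], [::]) ([::], [:: (a, b)])
| kink_left a b l :
    kink k ([:: Crossing k l a l b], [::]) ([::], [:: (a, b)]).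

(* The two strands are parallel, or antiparallel with each one on the right
   (resp. on the left) of the other. *)
Inductive bigon (k : kind) : tangle -> tangle -> Prop :=
| bigon_parallel a b c d m n :
    bigon k
      ([:: Crossing k a c m n; Crossing (opp_kind k) m n b d], [::])
      ([::], [:: (a, b); (c, d)])
| bigon_antiparallel_right a b c d m n :
    bigon k
      ([:: Crossing k n a m d; Crossing (opp_kind k) m c n b], [::])
      ([::], [:: (a, b); (c, d)])
| bigon_antiparallel_left a b c d m n :
    bigon k
      ([:: Crossing k a n d m; Crossing (opp_kind k) c m b n], [::])
      ([::], [:: (a, b); (c, d)]).

(* A strand [a3 -> b3] moves across a crossing of kind [k] of the upward strands
   [a1 -> b1] (from bottom left to top right) and [a2 -> b2] (from bottom right
   to top left), over both of them or under both of them. The moving strand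
   starts below the crossing and ends above it, running rightward or leftward,
   or it starts on the left of the crossing and ends on its right, running
   upward or downward. *)
Inductive slide (k : kind) (over : bool) : tangle -> tangle -> Prop :=
| slide_rightward a1 a2 a3 b1 b2 b3 u v w :
    slide k over
      ([:: cross_lr over a3 w a1 u; cross_lr over w b3 a2 v;
           Crossing k u v b2 b1], [::])
      ([:: Crossing k a1 a2 v u;
           cross_lr over a3 w v b2; cross_lr over w b3 u b1], [::])
| slide_leftward a1 a2 a3 b1 b2 b3 u v w :
    slide k over
      ([:: cross_rl over a3 w a2 v; cross_rl over w b3 a1 u;
           Crossing k u v b2 b1], [::])
      ([:: Crossing k a1 a2 v u;
           cross_rl over a3 w u b1; cross_rl over w b3 v b2], [::])
| slide_upward a1 a2 a3 b1 b2 b3 u v w :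
    slide k over
      ([:: cross_rl over a3 w a1 u; cross_lr over w b3 v b2;
           Crossing k u a2 v b1], [::])
      ([:: cross_lr over a3 w a2 v; cross_rl over w b3 u b1;
           Crossing k a1 v b2 u], [::])
| slide_downward a1 a2 a3 b1 b2 b3 u v w :
    slide k over
      ([:: cross_rl over a3 w v b2; cross_lr over w b3 a1 u;
           Crossing k u a2 v b1], [::])
      ([:: cross_lr over a3 w u b1; cross_rl over w b3 a2 v;
           Crossing k a1 v b2 u], [::]).

Inductive singular_move : tangle -> tangle -> Prop :=
| move_I k T T' : k != flat -> kink k T T' -> singular_move T T'
| move_II k T T' : k != flat -> bigon k T T' -> singular_move T T'
| move_III k over T T' :
    k != flat -> slide k over T T' -> singular_move T T'
| move_psII k a b c d m n : k != flat ->
    singular_move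
      ([:: Crossing flat a c m n; Crossing k m n b d], [::])
      ([:: Crossing k a c m n; Crossing flat m n b d], [::])
| move_psIII T T' : slide flat true T T' -> singular_move T T'
| move_psIII' T T' : slide flat false T T' -> singular_move T T'.

Inductive pseudo_move : tangle -> tangle -> Prop :=
| move_singular T T' : singular_move T T' -> pseudo_move T T'
| move_pI T T' : kink flat T T' -> pseudo_move T T'.

(* [D'] is obtained from [D] by replacing a tangle [T] with [T'], the rest [K]
   of the diagram being left unchanged. *)
Definition reidemeister (move : tangle -> tangle -> Prop) (D D' : diagram) :
  Prop :=
  exists T T' K,
    [/\ move T T', isotopic D (plug T K) & isotopic D' (plug T' K)].

Inductive equivalent (move : tangle -> tangle -> Prop) :
  diagram -> diagram -> Prop :=
| equivalent_isotopic (D D' : diagram) : isotopic D D' -> equivalent move D D'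
| equivalent_move D D' : reidemeister move D D' -> equivalent move D D'
| equivalent_sym D D' : equivalent move D D' -> equivalent move D' D
| equivalent_trans D D' D'' :
    equivalent move D D' -> equivalent move D' D'' -> equivalent move D D''.

Section Links.
Variable move : tangle -> tangle -> Prop.

Definition equivalentb : rel diagram := fun D D' => `[< equivalent move D D' >].

Lemma equivalentb_refl : reflexive equivalentb.
Proof.
move=> D; apply/asboolP/equivalent_isotopic; exists id; split=> //.
- by rewrite /relabel /= (@eq_map _ _ _ id) ?map_id //; case.
- by rewrite /relabel /= map_id.
Qed.

Lemma equivalentb_sym : symmetric equivalentb.
Proof.
by move=> D D'; apply/asboolP/asboolP; apply: equivalent_sym.
Qed.

Lemma equivalentb_trans : transitive equivalentb.
Proof.
move=> D' D D'' /asboolP h /asboolP h'.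
by apply/asboolP; apply: equivalent_trans h h'.
Qed.

Definition equivalent_rel :=
  EquivRel equivalentb equivalentb_refl equivalentb_sym equivalentb_trans.

Definition link : Type := {eq_quot equivalent_rel}.
Definition link_of (D : diagram) : link := \pi_{eq_quot equivalent_rel} D.

End Links.

Definition singular_link : Type := link singular_move.
Definition pseudolink : Type := link pseudo_move.

Definition semiarc (D : code) : finType := seq_sub (labels D).

Definition is_coloring (X : finType) (Q : psyquandle X) (D : code)
    (f : {ffun semiarc D -> X}) : bool :=
  all (fun c : crossing =>
    [forall sBL, forall sBR, forall sTL, forall sTR,
      [&& val (sBL : semiarc D) == bl c, val (sBR : semiarc D) == br c,
          val (sTL : semiarc D) == tl c & val (sTR : semiarc D) == tr c] ==>
      let x := f sBR in
      let y := f sTR in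
      match ckind c with
      | pos => (f sTL == utri Q x y) && (f sBL == otri Q y x)
      | neg => (f sTL == otri Q x y) && (f sBL == utri Q y x)
      | flat => (f sTL == udot Q x y) && (f sBL == odot Q y x)
      end]) D.1.

Definition ncolorings (X : finType) (Q : psyquandle X) (D : code) : nat :=
  #|[set f : {ffun semiarc D -> X} | is_coloring Q f]|.

(* Main.v *)
Require Import Defs.
From mathcomp Require Import all_boot.
From mathcomp Require Import generic_quotient boolp zify.

(** Cut a diagram along the circle bounding the disk in which a move takes
    place. The part outside the disk is the same before and after the move, so
    the two diagrams have equally many colorings as soon as, for each coloring
    of the semiarcs that meet the circle, the two tangles inside have equally
    many extensions. For the moves at hand this number is 0 or 1, for a reason
    common to all kinds of crossings: the colors of two adjacent ends of a
    crossing determine the colors of the other two. For ends on the same side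
    of the crossing this is the invertibility of [S] and [S'] or the definition
    of a coloring; for the two bottom or two top ends it is the invertibility
    of the maps [alpha] and [beta] ([fits_bottom], [fits_top], [fits_left],
    [fits_right]). Hence the colors of the circle determine those inside, and
    it remains to see that a coloring of the circle that extends to one tangle
    extends to the other.

    For kinks, bigons and p/sII this is read off the axioms. For the moves of
    type III, write the operations attached to a crossing of kind [k] as
    [tlop k] and [blop k]; the third biquandle axiom and (p/siii) then become
    three identities that are uniform in [k] and in the sign of the crossings
    of the moving strand ([slide_strand], [slide_tl], [slide_bl]). They say
    that the crossing before the passage of the strand, the crossing after it
    and the four crossings made by the strand with the four ends fit together
    as the six faces of a cube ([full_cube]). The two sides of a slide are
    complementary triples of faces, each around a corner of the cube, and by
    invertibility three faces around a corner extend to a full cube. The four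
    directions of the moving strand are the four pairs of opposite corners.

    The bookkeeping: [plug] glues a tangle into the rest of the diagram by
    merging labels, and [plug_code_ncol] shows that colorings of the result are
    the colorings of the unglued pieces that are constant along the bare
    strands; [exchange_plug_ncol] is the counting argument above. Finally an
    invariant of moves and isotopies descends to the quotient. *)

Set Implicit Arguments.
Unset Strict Implicit.
Unset Printing Implicit Defensive.

Section Colorings.
Variables (X : finType) (Q : psyquandle X).
Implicit Types (k : kind).

Let QP := psyquandleP Q.
Let BP := psy_biquandle QP.

(** * The operations attached to a crossing *)

(** With [x] and [y] the colors of BR and TR at a crossing of kind [k], TL has
    color [tlop k x y] and BL has color [blop k y x]. *)
Definition tlop k : X -> X -> X :=
  match k with pos => utri Q | neg => otri Q | flat => udot Q end.
Definition blop k : X -> X -> X :=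
  match k with pos => otri Q | neg => utri Q | flat => odot Q end.

Lemma tlop_bij k y : bijective (fun x => tlop k x y).
Proof.
case: k => /=.
- exact: (biq_ut_bij BP).
- exact: (biq_ot_bij BP).
- exact: (psy_ud_bij QP).
Qed.

Lemma blop_bij k y : bijective (fun x => blop k x y).
Proof.
case: k => /=.
- exact: (biq_ot_bij BP).
- exact: (biq_ut_bij BP).
- exact: (psy_od_bij QP).
Qed.

Lemma side_bij k :
  bijective (fun p : X * X => (blop k p.2 p.1, tlop k p.1 p.2)).
Proof.
case: k => /=.
- exact: (biq_S_bij BP).
- have [h hK Kh] := biq_S_bij BP.
  exists (fun p => let: (x, y) := h (p.2, p.1) in (y, x)) => [[x y]|[x y]] /=.
    by rewrite (hK (y, x)).
  by have := Kh (y, x); case: (h (y, x)) => u v [] /= <- <-.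
- exact: (psy_S'_bij QP).
Qed.

Lemma tlop_inj k y x x' : tlop k x y = tlop k x' y -> x = x'.
Proof. exact: bij_inj (tlop_bij k y) _ _. Qed.

Lemma blop_inj k y x x' : blop k x y = blop k x' y -> x = x'.
Proof. exact: bij_inj (blop_bij k y) _ _. Qed.

Lemma side_inj k x y x' y' :
  blop k y x = blop k y' x' -> tlop k x y = tlop k x' y' -> x = x' /\ y = y'.
Proof.
move=> e1 e2; suff [-> ->] : (x, y) = (x', y') by [].
by apply: (bij_inj (side_bij k)); rewrite /= e1 e2.
Qed.

Lemma tlop_onto k y x : exists x', x = tlop k x' y.
Proof. by have [h _ hK] := tlop_bij k y; exists (h x); rewrite hK. Qed.

Lemma blop_onto k y x : exists x', x = blop k x' y.
Proof. by have [h _ hK] := blop_bij k y; exists (h x); rewrite hK. Qed.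

Lemma side_onto k x y :
  exists x' y', x = blop k y' x' /\ y = tlop k x' y'.
Proof.
have [h _ hK] := side_bij k; have := hK (x, y).
by case: (h (x, y)) => x' y' [<- <-]; exists x', y'.
Qed.

Lemma tlop_opp k : k != flat -> tlop (opp_kind k) = blop k.
Proof. by case: k. Qed.

Lemma blop_opp k : k != flat -> blop (opp_kind k) = tlop k.
Proof. by case: k. Qed.

Lemma diag_op k : k != flat \/ pI_adequate Q ->
  forall x, tlop k x x = blop k x x.
Proof.
by case: k => [_|_|[//|pI]] x /=; rewrite ?(biq_diag BP).
Qed.

(** The third biquandle axiom and (p/siii), for a strand whose crossings are of
    kind [s] and which passes a crossing of kind [k]. Passing from [pos] to
    [neg] exchanges the two triangle operations, and the axioms are stable
    under this exchange. *)
Lemma slide_strand s k x y z : s != flat ->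
  blop s (blop s z x) (blop k y x) = blop s (blop s z y) (tlop k x y).
Proof.
case: s => // _; case: k => /=.
- exact: (biq_oo BP).
- by rewrite (biq_oo BP).
- exact: (psy_iii1 QP).
- by rewrite (biq_uu BP).
- exact: (biq_uu BP).
- exact: (psy_iii2 QP).
Qed.

Lemma slide_tl s k x y z : s != flat ->
  tlop s (tlop k x y) (blop s z y) = tlop k (tlop s x z) (tlop s y z).
Proof.
case: s => // _; case: k => /=.
- by rewrite (biq_uu BP).
- by rewrite (biq_uo BP).
- by rewrite (psy_iii4 QP).
- by rewrite (biq_uo BP).
- by rewrite (biq_oo BP).
- by rewrite (psy_iii5 QP).
Qed.

Lemma slide_bl s k x y z : s != flat ->
  tlop s (blop k y x) (blop s z x) = blop k (tlop s y z) (tlop s x z).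
Proof.
case: s => // _; case: k => /=.
- by rewrite (biq_uo BP).
- by rewrite (biq_uu BP).
- by rewrite (psy_iii6 QP).
- by rewrite (biq_oo BP).
- by rewrite (biq_uo BP).
- by rewrite (psy_iii3 QP).
Qed.

(** * Colors around one crossing *)

Definition fits k xbl xbr xtl xtr : bool :=
  (xtl == tlop k xbr xtr) && (xbl == blop k xtr xbr).

Lemma fitsP k xbl xbr xtl xtr :
  reflect (xtl = tlop k xbr xtr /\ xbl = blop k xtr xbr)
          (fits k xbl xbr xtl xtr).
Proof. by apply: (iffP andP) => -[/eqP-> /eqP->]. Qed.

Lemma fits_intro k x y : fits k (blop k y x) x (tlop k x y) y.
Proof. by rewrite /fits !eqxx. Qed.

Lemma fits_bottom k p q r r' t t' : fits k p q r t -> fits k p q r' t' ->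
  r = r' /\ t = t'.
Proof. by move=> /fitsP[-> ->] /fitsP[-> /blop_inj->]. Qed.

Lemma fits_top k p p' q q' r t : fits k p q r t -> fits k p' q' r t ->
  p = p' /\ q = q'.
Proof. by move=> /fitsP[-> ->] /fitsP[/tlop_inj-> ->]. Qed.

Lemma fits_left k p q q' r t t' : fits k p q r t -> fits k p q' r t' ->
  q = q' /\ t = t'.
Proof. by move=> /fitsP[-> ->] /fitsP[e1 e2]; apply: side_inj e2 e1. Qed.

Lemma fits_right k p p' q r r' t : fits k p q r t -> fits k p' q r' t ->
  p = p' /\ r = r'.
Proof. by move=> /fitsP[-> ->] /fitsP[-> ->]. Qed.

(** A crossing of the opposite sign is the mirror image in a horizontal line
    with both strands reversed. *)
Lemma fits_opp k xbl xbr xtl xtr : k != flat ->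
  fits (opp_kind k) xbl xbr xtl xtr = fits k xtl xtr xbl xbr.
Proof. by move=> kN; rewrite /fits tlop_opp // blop_opp // andbC. Qed.

(** The four equations of axiom (p/sii) are those of the two sides of move
    p/sII, with the unknowns [w] and [z] in the roles of [n'] and [d] for a
    positive crossing, and of [d] and [n'] for a negative one. *)
Lemma psII_fits k a b c d m n : k != flat ->
  fits k a c m n -> fits flat m n b d ->
  exists m' n', fits flat a c m' n' && fits k m' n' b d.
Proof.
move=> kN /fitsP[-> ->] /fitsP[-> /= emd].
have [w [z [ex ey ew ez]]] : exists w z,
    [/\ tlop k c n = odot Q z n, blop k n c = odot Q w c,
        tlop k w z = udot Q n z & blop k z w = udot Q c w].
  case: k kN emd => // _ _ /=.
    by have [[w z] [[? ? ? ?] _]] := psy_ii QP c n; exists w, z.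
  by have [[w z] [[? ? ? ?] _]] := psy_ii QP n c; exists z, w.
exists (udot Q c w), w; rewrite ey fits_intro /=; apply/fitsP.
have <- : z = d by apply: (@blop_inj flat n); rewrite /= -ex.
by rewrite ew ez.
Qed.

(** The bottom colors [a] and [c] determine everything on both sides, so the
    converse follows by completing them to a coloring of the other side and
    applying [psII_fits]. *)
Lemma psII_fits_rev k a b c d m n : k != flat ->
  fits flat a c m n -> fits k m n b d ->
  exists m' n', fits k a c m' n' && fits flat m' n' b d.
Proof.
move=> kN /fitsP[em ea] /fitsP[eb em'].
have [n' ea'] := blop_onto k c a.
have [d' ed'] := blop_onto flat n' (tlop k c n').
exists (tlop k c n'), n'.
have f1 : fits k a c (tlop k c n') n' by rewrite ea' fits_intro.
have f2 : fits flat (tlop k c n') n' (tlop flat n' d') d'.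
  by rewrite {1}ed' fits_intro.
have [m2 [n2 /andP[/fitsP[em2 ea2] /fitsP[eb' em2']]]] := psII_fits kN f1 f2.
have en : n2 = n by apply: (@blop_inj flat c); rewrite -ea -ea2.
have ed : d' = d.
  by apply: (@blop_inj k n); rewrite -em' em -en -em2 em2'.
by rewrite f1 -ed /= eb -ed -en -eb' f2.
Qed.

(** Since [tlop k] and [blop k] agree on the diagonal, [tlop k l l] determines
    the image of [(l, l)] under [S] or [S'], hence [l]; an injective self-map of
    the finite set [X] is onto. *)
Lemma kink_fits k x : k != flat \/ pI_adequate Q ->
  exists l, x = tlop k l l.
Proof.
move=> kQ; have inj : injective (fun l => tlop k l l).
  move=> l l' e.
  by have [] := @side_inj k l l l' l'; rewrite // -!diag_op.
by have [h _ hK] := injF_bij inj; exists (h x); rewrite hK.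
Qed.

(** * The cube of a strand passing a crossing *)

(** The ends BL, BR, TR, TL of a crossing of kind [k] have colors [e1], [e2],
    [f1], [f2] on one side of a strand and [e1'], [e2'], [f1'], [f2'] on the
    other side; the strand has colors [W], [S], [E], [N] in the regions of the
    plane between consecutive ends. In each crossing of the strand with an end,
    the strand is the one from BL to TR. *)
Definition cube s k W E S N e1 e2 f1 f2 e1' e2' f1' f2' :=
  [/\ fits k e1 e2 f2 f1 && fits k e1' e2' f2' f1',
      fits s W e1 e1' S && fits s S e2 e2' E
    & fits s W f2 f2' N && fits s N f1 f1' E].

(** The colors [e2], [f1] and [E] of three edges at a corner, here [x], [y] and
    [z], can be chosen freely: the three faces at that corner define all others
    but [W], [e1'] and [f2'], and the slide identities say that the remaining
    three faces agree on these. *)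
Lemma full_cube s k x y z : s != flat ->
  cube s k (blop s (blop s z y) (tlop k x y)) z (blop s z x) (blop s z y)
    (blop k y x) x y (tlop k x y)
    (tlop s (blop k y x) (blop s z x)) (tlop s x z)
    (tlop s y z) (tlop s (tlop k x y) (blop s z y)).
Proof.
move=> sN; split; rewrite ?fits_intro ?andbT //=.
  by apply/fitsP; rewrite slide_tl // slide_bl.
by rewrite -slide_strand // fits_intro.
Qed.

Section Slides.
Variables (s k : kind).
Hypothesis sN : s != flat.

(** Three faces around a corner extend to a cube, for each of the eight
    corners. In each case invertibility recovers the colors [e2], [f1] and [E]
    from the given faces, and [full_cube] has to agree with these faces by
    uniqueness. *)
Lemma cube_k'_e2_e1 W E S e1 e2 e1' e2' f1' f2' :
  fits k e1' e2' f2' f1' -> fits s S e2 e2' E -> fits s W e1 e1' S ->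
  exists N f1 f2, cube s k W E S N e1 e2 f1 f2 e1' e2' f1' f2'.
Proof.
move=> /fitsP[-> ->] /fitsP[-> ->] /fitsP[e ->]; move: e.
have [f1 ->] := tlop_onto s E f1'; rewrite -slide_bl // => /tlop_inj <-.
exists (blop s E f1), f1, (tlop k e2 f1).
by rewrite -?slide_bl // -?slide_tl // slide_strand //; apply: full_cube.
Qed.

Lemma cube_k_f1_f2 W E N e1 e2 f1 f2 f1' f2' :
  fits k e1 e2 f2 f1 -> fits s N f1 f1' E -> fits s W f2 f2' N ->
  exists S e1' e2', cube s k W E S N e1 e2 f1 f2 e1' e2' f1' f2'.
Proof.
move=> /fitsP[-> ->] /fitsP[-> ->] /fitsP[-> ->].
by do 3!eexists; apply: full_cube.
Qed.

Lemma cube_k_e2_e1 W E S e1 e2 f1 f2 e1' e2' :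
  fits k e1 e2 f2 f1 -> fits s S e2 e2' E -> fits s W e1 e1' S ->
  exists N f1' f2', cube s k W E S N e1 e2 f1 f2 e1' e2' f1' f2'.
Proof.
move=> /fitsP[-> ->] /fitsP[-> ->] /fitsP[-> ->].
by do 3!eexists; rewrite slide_strand //; apply: full_cube.
Qed.

Lemma cube_k'_f1_f2 W E N f1 f2 e1' e2' f1' f2' :
  fits k e1' e2' f2' f1' -> fits s N f1 f1' E -> fits s W f2 f2' N ->
  exists S e1 e2, cube s k W E S N e1 e2 f1 f2 e1' e2' f1' f2'.
Proof.
move=> /fitsP[-> ->] /fitsP[-> ->] /fitsP[e ->]; move: e.
have [e2 ->] := tlop_onto s E e2'; rewrite -slide_tl // => /tlop_inj <-.
exists (blop s E e2), (blop k f1 e2), e2.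
by rewrite -?slide_bl // -?slide_tl //; apply: full_cube.
Qed.

Lemma cube_k_e1_f2 W S N e1 e2 f1 f2 e1' f2' :
  fits k e1 e2 f2 f1 -> fits s W e1 e1' S -> fits s W f2 f2' N ->
  exists E e2' f1', cube s k W E S N e1 e2 f1 f2 e1' e2' f1' f2'.
Proof.
move=> /fitsP[-> ->] /fitsP[-> ->] /fitsP[-> e]; move: e.
have [E ->] := blop_onto s e2 S; rewrite slide_strand // => /blop_inj <-.
by do 3!eexists; apply: full_cube.
Qed.

Lemma cube_k'_e2_f1 E S N e2 f1 e1' e2' f1' f2' :
  fits k e1' e2' f2' f1' -> fits s S e2 e2' E -> fits s N f1 f1' E ->
  exists W e1 f2, cube s k W E S N e1 e2 f1 f2 e1' e2' f1' f2'.
Proof.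
move=> /fitsP[-> ->] /fitsP[-> ->] /fitsP[-> ->].
exists (blop s (blop s E f1) (tlop k e2 f1)), (blop k f1 e2), (tlop k e2 f1).
by rewrite -?slide_bl // -?slide_tl //; apply: full_cube.
Qed.

Lemma cube_k'_e1_f2 W S N e1 f2 e1' e2' f1' f2' :
  fits k e1' e2' f2' f1' -> fits s W e1 e1' S -> fits s W f2 f2' N ->
  exists E e2 f1, cube s k W E S N e1 e2 f1 f2 e1' e2' f1' f2'.
Proof.
move=> /fitsP[-> ->] /fitsP[e1E ->] /fitsP[e2E eN]; move: e1E e2E eN.
have [e2 [E [-> ->]]] := side_onto s S e2'.
have [f1 ->] := tlop_onto s E f1'; rewrite -slide_bl // => /tlop_inj <-.
rewrite -slide_tl // slide_strand // => ef eN.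
have [<- <-] := side_inj eN ef; exists E, e2, f1.
exact: full_cube.
Qed.

Lemma cube_k_e2_f1 E S N e1 e2 f1 f2 e2' f1' :
  fits k e1 e2 f2 f1 -> fits s S e2 e2' E -> fits s N f1 f1' E ->
  exists W e1' f2', cube s k W E S N e1 e2 f1 f2 e1' e2' f1' f2'.
Proof.
move=> /fitsP[-> ->] /fitsP[-> ->] /fitsP[-> ->].
by do 3!eexists; apply: full_cube.
Qed.

End Slides.

(** * Counting colorings by functions on all labels *)

(** The number of functions on the labels in [L] that extend to a function on
    all labels with property [P]. Colorings of different diagrams are
    compared as functions on the common type [nat], so that no transport
    between the types of their semiarcs is needed. *)
Definition ncol (L : seq nat) (P : (nat -> X) -> Prop) : nat :=
  #|[set f : {ffun seq_sub L -> X} |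
     `[< exists2 g, P g & forall s, f s = g (val s) >]]|.

(** The relation [R] plays the part of an injection from the restrictions to [L]
    of the functions in [P] to the restrictions to [L'] of those in [P']. *)
Lemma leq_ncol L L' (P P' : (nat -> X) -> Prop)
    (R : (nat -> X) -> (nat -> X) -> Prop) :
  (forall g, P g -> exists2 g', P' g' & R g g') ->
  (forall g g' h h', P g -> P h -> R g g' -> R h h' ->
     {in L', g' =1 h'} -> {in L, g =1 h}) ->
  ncol L P <= ncol L' P'.
Proof.
move=> tot inj; rewrite /ncol; set S := [set f | _]; set S' := [set f | _].
have [->|[f0 f0S]] := set_0Vmem S; first by rewrite cards0.
pose rel (f : {ffun seq_sub L -> X}) (f' : {ffun seq_sub L' -> X}) :=
  exists g g', [/\ P g, R g g', forall s, f s = g (val s)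
                 & forall s, f' s = g' (val s)].
have relS f : f \in S -> exists2 f', f' \in S' & rel f f'.
  rewrite inE => /asboolP[g Pg fg]; have [g' P'g' Rg] := tot g Pg.
  exists [ffun s => g' (val s)].
    by rewrite inE; apply/asboolP; exists g' => // s; rewrite ffunE.
  by exists g, g'; split=> // s; rewrite ffunE.
have [f1 _ _] := relS f0 f0S.
have /choice[F FP] : forall f, exists f', f \in S -> f' \in S' /\ rel f f'.
  move=> f; have [/relS[f' ? ?]|_] := boolP (f \in S); first by exists f'.
  by exists f1.
rewrite -(@card_in_imset _ _ F); last first.
  move=> f h /FP[_ [g [g' [Pg Rg fg Fg]]]] /FP[_ [k [k' [Pk Rk hk Fk]]]] e.
  apply/ffunP => s; rewrite fg hk.
  apply: (inj g g' k k') (valP s) => // x xL'.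
  by have := Fg (SeqSub xL'); rewrite e Fk.
by apply/subset_leq_card/subsetP => _ /imsetP[f /FP[? _] ->].
Qed.

(** * Colorings of planar diagram codes *)

Definition colors (g : nat -> X) (c : crossing) : bool :=
  fits (ckind c) (g (bl c)) (g (br c)) (g (tl c)) (g (tr c)).

Definition code_ncol (D : code) : nat :=
  ncol (labels D) (fun g => all (colors g) D.1).

Lemma mem_bl (xs : seq crossing) c : c \in xs -> bl c \in in_labels xs.
Proof. by move=> cxs; apply/flatten_mapP; exists c; rewrite ?inE ?eqxx. Qed.

Lemma mem_br (xs : seq crossing) c : c \in xs -> br c \in in_labels xs.
Proof.
by move=> cxs; apply/flatten_mapP; exists c; rewrite ?inE ?eqxx ?orbT.
Qed.

Lemma mem_tl (xs : seq crossing) c : c \in xs -> tl c \in out_labels xs.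
Proof. by move=> cxs; apply/flatten_mapP; exists c; rewrite ?inE ?eqxx. Qed.

Lemma mem_tr (xs : seq crossing) c : c \in xs -> tr c \in out_labels xs.
Proof.
by move=> cxs; apply/flatten_mapP; exists c; rewrite ?inE ?eqxx ?orbT.
Qed.

Lemma eq_in_colors xs g h : {in in_labels xs ++ out_labels xs, g =1 h} ->
  all (colors g) xs = all (colors h) xs.
Proof.
move=> gh; apply: eq_in_all => c cxs; rewrite /colors !gh //;
  by rewrite mem_cat ?(mem_bl, mem_br) ?(mem_tl, mem_tr) ?orbT.
Qed.

Lemma is_coloringE (D : code) (f : {ffun semiarc D -> X}) (g : nat -> X) :
  {subset out_labels D.1 <= labels D} ->
  (forall s, f s = g (val s)) -> is_coloring Q f = all (colors g) D.1.
Proof.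
move=> out fg; apply: eq_in_all => c cD.
have inL x : x \in in_labels D.1 -> x \in labels D by rewrite mem_cat => ->.
apply/idP/idP => [|gc].
  move=> /forallP/(_ (SeqSub (inL _ (mem_bl cD)))).
  move=> /forallP/(_ (SeqSub (inL _ (mem_br cD)))).
  move=> /forallP/(_ (SeqSub (out _ (mem_tl cD)))).
  move=> /forallP/(_ (SeqSub (out _ (mem_tr cD)))).
  by rewrite !eqxx /= /colors /fits !fg /=; case: (ckind c).
apply/forallP => sBL; apply/forallP => sBR.
apply/forallP => sTL; apply/forallP => sTR.
apply/implyP => /and4P[/eqP e1 /eqP e2 /eqP e3 /eqP e4].
move: gc; rewrite /colors /fits !fg -e1 -e2 -e3 -e4.
by case: (ckind c).
Qed.

(** A coloring extends to all labels only if there is a color, which the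
    existence of a semiarc guarantees: the empty diagram has one coloring by
    the empty set, although there is no function from [nat] to it. *)
Lemma ncolorings_code (D : code) : labels D != [::] ->
  {subset out_labels D.1 <= labels D} -> ncolorings Q D = code_ncol D.
Proof.
move=> DN0 out; apply: eq_card => f; rewrite !inE; apply/idP/asboolP.
  have [x xD] : exists x, x \in labels D.
    by case: (labels D) DN0 => // x s _; exists x; rewrite mem_head.
  pose g y := if insub y is Some s then f s else f (SeqSub xD).
  have fg s : f s = g (val s) by rewrite /g valK.
  by rewrite (is_coloringE out fg) => gD; exists g.
by case=> g gD fg; rewrite (is_coloringE out fg).
Qed.

Lemma colors_relabel g f xs :
  all (colors g) (map (relabel_crossing f) xs) = all (colors (g \o f)) xs.
Proof. by rewrite all_map. Qed.

Lemma in_labels_cat xs ys : in_labels (xs ++ ys) = in_labels xs ++ in_labels ys.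
Proof. by rewrite /in_labels map_cat flatten_cat. Qed.

Lemma out_labels_cat xs ys :
  out_labels (xs ++ ys) = out_labels xs ++ out_labels ys.
Proof. by rewrite /out_labels map_cat flatten_cat. Qed.

Lemma in_labels_relabel f xs :
  in_labels (map (relabel_crossing f) xs) = map f (in_labels xs).
Proof. by elim: xs => //= c xs; rewrite /in_labels /= => ->. Qed.

Lemma out_labels_relabel f xs :
  out_labels (map (relabel_crossing f) xs) = map f (out_labels xs).
Proof. by elim: xs => //= c xs; rewrite /out_labels /= => ->. Qed.

Lemma perm_in_labels xs ys :
  perm_eq xs ys -> perm_eq (in_labels xs) (in_labels ys).
Proof. by move=> xy; apply/perm_flatten/perm_map. Qed.

Lemma perm_out_labels xs ys :
  perm_eq xs ys -> perm_eq (out_labels xs) (out_labels ys).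
Proof. by move=> xy; apply/perm_flatten/perm_map. Qed.

(** * Invariance under isotopy *)

Lemma isotopic_labels D E : isotopic D E -> exists f, [/\ injective f,
  perm_eq (map f (in_labels D.1)) (in_labels E.1),
  perm_eq (map f (out_labels D.1)) (out_labels E.1),
  perm_eq (map f (labels D)) (labels E)
  & forall g, all (colors g) E.1 = all (colors (g \o f)) D.1].
Proof.
case=> f [fI p1 p2]; exists f.
have pin : perm_eq (map f (in_labels D.1)) (in_labels E.1).
  by rewrite -in_labels_relabel perm_in_labels.
split=> //; first by rewrite -out_labels_relabel perm_out_labels.
- by rewrite map_cat perm_cat.
- by move=> g; rewrite -colors_relabel -(perm_all _ p1).
Qed.

Lemma isotopic_well_formed D E : isotopic D E -> well_formed D -> well_formed E.
Proof.
move=> /isotopic_labels[f [fI pin pout pl _]] /andP[uD pD].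
rewrite /well_formed -(perm_uniq pl) map_inj_uniq // uD /=.
by rewrite -(permPl pin) -(permPr pout) perm_map.
Qed.

Lemma isotopic_code_ncol D E : isotopic D E -> code_ncol D = code_ncol E.
Proof.
move=> /isotopic_labels[f [fI pin pout pl colE]].
pose A := labels D ++ in_labels D.1 ++ out_labels D.1.
apply/eqP; rewrite eqn_leq; apply/andP; split.
  apply: (@leq_ncol _ _ _ _ (fun g g' => {in A, g =1 g' \o f})).
    (* the inverse of [f] on the labels, which are finitely many *)
    move=> g gD; exists (fun y => g (nth 0 A (index y (map f A)))); last first.
      by move=> x xA /=; rewrite index_map // nth_index.
    rewrite colE -(@eq_in_colors _ g) // => x xD /=.
    by rewrite index_map // nth_index // mem_cat xD orbT.
  move=> g g' h h' _ _ gg' hh' e x xD.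
  have xA : x \in A by rewrite mem_cat xD.
  by rewrite gg' // hh' //=; apply: e; rewrite -(perm_mem pl) map_f.
apply: (@leq_ncol _ _ _ _ (fun g g' => g' = g \o f)).
  by move=> g; rewrite colE; exists (g \o f).
move=> g _ h _ _ _ -> -> e y; rewrite -(perm_mem pl) => /mapP[x xD ->].
exact: e.
Qed.

Lemma isotopic_ncolorings (D E : code) :
  well_formed D -> isotopic D E -> ncolorings Q D = ncolorings Q E.
Proof.
move=> wD iso; have wE := isotopic_well_formed iso wD.
have out C : well_formed C -> {subset out_labels C.1 <= labels C}.
  by move=> /andP[_ p] x; rewrite -(perm_mem p) mem_cat => ->.
have [f [fI pin _ pl _]] := isotopic_labels iso.
have [D0|DN0] := eqVneq (labels D) [::]; last first.
  rewrite !ncolorings_code ?(isotopic_code_ncol iso) //; try exact: out.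
  by rewrite -size_eq0 -(perm_size pl) size_map size_eq0.
have nilC C : labels C = [::] -> C = ([::], [::]).
  by case: C => [[|c xs] []].
rewrite (nilC D) // (nilC E) //.
by apply/nilP; rewrite /nilp -(perm_size pl) D0.
Qed.

(** * Colorings of a diagram with a tangle plugged in *)

Definition respects (g : nat -> X) (js : seq (nat * nat)) : bool :=
  all (fun j => g j.1 == g j.2) js.

Definition sat (g : nat -> X) (T : tangle) : bool :=
  all (colors g) T.1 && respects g T.2.

(** The labels at which strands start, inside the disk, towards a crossing or
    towards the boundary; [tangle_outs] are those at which they end. *)
Definition tangle_ins (T : tangle) : seq nat := in_labels T.1 ++ unzip1 T.2.
Definition tangle_outs (T : tangle) : seq nat := out_labels T.1 ++ unzip2 T.2.

Lemma relabel_comp f f' xs :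
  map (relabel_crossing (f' \o f)) xs =
  map (relabel_crossing f') (map (relabel_crossing f) xs).
Proof. by rewrite -map_comp; apply: eq_map. Qed.

(** Splicing renames labels by some [r] that only identifies labels joined by
    the strands [js]. In the last clause, a set [S] of labels each of which is
    a label of [D] or starts a strand, and which contains the ends of the
    strands, is mapped to labels of the result: following the strands from an
    element of [S], one arrives at a label of [D] or runs into a cycle, which
    closes up into a crossingless component. *)
Lemma splice_renaming js f D (E := splice f js D) : exists r,
  [/\ E.1 = map (relabel_crossing r) D.1,
      forall j, j \in js -> r (f j.1) = r (f j.2),
      forall g : nat -> X, respects (g \o f) js -> g \o r =1 g,
      {subset labels E <= map r (labels D ++ map f (unzip1 js))}
    & forall S : seq nat,
        {in S, forall x, f x \in labels D ++ map f (unzip1 js)} ->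
        {subset unzip2 js <= S} -> {in S, forall x, r (f x) \in labels E}].
Proof.
rewrite {}/E; elim: js f D => [|[a b] js IHjs] f D.
  exists id; split=> //=.
  - by rewrite -[LHS]map_id; apply/esym/eq_map; case.
  - by move=> x; rewrite cats0 map_id.
  - by move=> S SD _ x /SD; rewrite cats0.
rewrite [splice _ _ _]/=; case: (eqVneq (f a) (f b)) => [fab|fabN].
  have [r [E1 rjs rg subE supE]] := IHjs f (D.1, f a :: D.2).
  have memD x : (x \in labels (D.1, f a :: D.2) ++ map f (unzip1 js)) =
      (x \in labels D ++ map f (unzip1 ((a, b) :: js))).
    by rewrite /labels /= !(mem_cat, inE) -!orbA; do !bool_congr.
  exists r; split=> //.
  - by move=> j; rewrite inE => /predU1P[->|/rjs] //=; rewrite fab.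
  - by move=> g /= /andP[_ /rg].
  - move=> x /subE /mapP[y yD ->]; rewrite map_f //; by rewrite -memD.
  - move=> S SD jsS; apply: supE => x xS; first by rewrite memD SD.
    by apply: jsS; rewrite inE xS orbT.
set q := rename (f b) (f a); have qb : q (f b) = q (f a).
  by rewrite /q /rename eqxx (negPf fabN).
have [r [E1 rjs rg subE supE]] := IHjs (q \o f) (relabel q D).
have labq : labels (relabel q D) = map q (labels D).
  by rewrite /labels map_cat /= in_labels_relabel.
exists (r \o q); split.
- by rewrite E1 relabel_comp.
- by move=> j; rewrite inE => /predU1P[->|/rjs] //=; rewrite qb.
- move=> g /= /andP[/eqP gab gjs].
  have gq : g \o q =1 g by move=> x; rewrite /= /q /rename; case: eqP => // ->.
  move=> x /=; rewrite [LHS](rg g) ?[LHS]gq //.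
  by apply: etrans gjs; apply: eq_all => j /=; rewrite ![g (q _)]gq.
- move=> x /subE; rewrite labq map_comp -map_cat map_comp => /mapP[y yD ->].
  apply: map_f; case/mapP: yD => z zD ->; apply: map_f.
  by move: zD; rewrite !mem_cat /= inE => /orP[->|->]; rewrite ?orbT.
- move=> S SD jsS x xS; apply: supE (S) _ _ x xS => [x xS|x xjs]; last first.
    by apply: jsS; rewrite inE xjs orbT.
  rewrite labq map_comp -map_cat.
  have tlD y : f y \in labels D ++ map f (unzip1 ((a, b) :: js)) ->
      f y != f a -> f y \in labels D ++ map f (unzip1 js).
    by rewrite !mem_cat /= inE => h /negPf yaN; move: h; rewrite yaN.
  have [xa|xaN] := eqVneq (f x) (f a); last exact/map_f/tlD/xaN/SD.
  by rewrite /= xa -qb; apply/map_f/tlD; rewrite 1?eq_sym ?SD ?jsS ?mem_head.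
Qed.

(** Colorings of a tangle and its complement before they are glued. *)
Definition plug_ncol T (K : code) : nat :=
  ncol (tangle_ins T ++ labels K) (fun g => sat g T && all (colors g) K.1).

(** The hypothesis says that a strand that ends at some label continues from
    it, in the tangle or in its complement. *)
Lemma plug_renaming T K (L := tangle_ins T ++ labels K) (E := plug T K) :
  {subset tangle_outs T ++ out_labels K.1 <= tangle_ins T ++ in_labels K.1} ->
  exists r, [/\ E.1 = map (relabel_crossing r) (T.1 ++ K.1),
      forall j, j \in T.2 -> r j.1 = r j.2,
      forall g : nat -> X, respects g T.2 -> g \o r =1 g,
      {subset labels E <= map r L}
    & {in L, forall x, r x \in labels E}].
Proof.
rewrite {}/E /plug => TK; set D := (T.1 ++ K.1, K.2).
have [r [E1 rjs rg subE supE]] := splice_renaming T.2 id D.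
have memL : labels D ++ unzip1 T.2 =i L.
  move=> x; rewrite /L /tangle_ins /labels /= in_labels_cat !mem_cat.
  by rewrite -!orbA; do !bool_congr.
rewrite !map_id in subE supE; exists r; split=> //.
  by move=> x /subE /mapP[y yL ->]; rewrite map_f // -memL.
apply: supE => y; rewrite ?memL // => yT.
have /TK : y \in tangle_outs T ++ out_labels K.1 by rewrite !mem_cat yT orbT.
by rewrite /L /labels !mem_cat => /orP[->|->]; rewrite ?orbT.
Qed.

Lemma plug_labels_neq0 T K :
  {subset tangle_outs T ++ out_labels K.1 <= tangle_ins T ++ in_labels K.1} ->
  tangle_ins T != [::] -> labels (plug T K) != [::].
Proof.
move=> /plug_renaming[r [_ _ _ _ sup]].
case: (tangle_ins T) sup => // x s sup _.
by apply: contraTneq (sup x _) => [->|]; rewrite ?mem_head.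
Qed.

(** A coloring [g] after gluing gives [g \o r] before gluing, where [r] is the
    renaming; a coloring before gluing that is constant along the bare strands
    is invariant under [r], hence is itself a coloring after gluing. *)
Lemma plug_code_ncol T K :
  {subset tangle_outs T ++ out_labels K.1 <= tangle_ins T ++ in_labels K.1} ->
  code_ncol (plug T K) = plug_ncol T K.
Proof.
move=> /plug_renaming[r [E1 rjs rg subE supE]].
have colE g : all (colors g) (plug T K).1 =
    all (colors (g \o r)) T.1 && all (colors (g \o r)) K.1.
  by rewrite E1 colors_relabel all_cat.
apply/eqP; rewrite eqn_leq; apply/andP; split.
  apply: (@leq_ncol _ _ _ _ (fun g g' => g' = g \o r)).
    move=> g; rewrite colE => /andP[gT gK]; exists (g \o r) => //.
    rewrite /sat gT gK !andbT; apply/allP => j /rjs /= ->; exact: eqxx.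
  by move=> g _ h _ _ _ -> -> e x /subE /mapP[y yL ->]; apply: e.
apply: (@leq_ncol _ _ _ _ (fun g g' => g' = g /\ g \o r =1 g)).
  move=> g /andP[/andP[gT gjs] gK]; exists g; last by split=> //; apply: rg.
  have gr : g \o r =1 g by apply: rg.
  by rewrite colE !(@eq_in_colors _ (g \o r) g) ?gT.
move=> g g' h h' _ _ [-> gr] [-> hr] e x xL.
by rewrite -[LHS]gr -[RHS]hr /= e // supE.
Qed.

(** * Exchanging tangles *)

(** Any [g'] with the prescribed colors on [I] and [B] will do: such a function
    can be obtained from [g] by changing it on [I] only once [I] and [B] are
    known to be disjoint, which depends on the diagram around the tangle. *)
Definition recolorable (I B : seq nat) T T' := forall g, sat g T ->
  exists2 vals, size vals = size I & forall g', map g' I = vals ->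
    map g' B = map g B -> sat g' T'.

Definition rigid (I B : seq nat) T := forall g h, sat g T -> sat h T ->
  map g B = map h B -> map g I = map h I.

Definition has_ends (I bin bout : seq nat) T :=
  perm_eq (tangle_ins T) (I ++ bin) && perm_eq (tangle_outs T) (I ++ bout).

(** The strands cross the boundary of the disk at [bin] and [bout], and [I] and
    [I'] are the labels inside it. The latter is separate from the former
    because it is empty when [T'] consists of bare strands; the former suffices
    for recoloring in both directions. A strand has to enter the disk for the
    diagrams to have a semiarc, as in [ncolorings_code]. *)
Record exchange (I I' bin bout : seq nat) T T' : Prop := Exchange {
  exchange_crossings : T.2 = [::];
  exchange_open : bin != [::];
  exchange_ends : has_ends I bin bout T;
  exchange_ends' : has_ends I' bin bout T';
  exchange_to : recolorable I (bin ++ bout) T T';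
  exchange_from : recolorable I (bin ++ bout) T' T;
  exchange_rigid : rigid I (bin ++ bout) T;
  exchange_rigid' : rigid I' (bin ++ bout) T'
}.

Definition exchangeable T T' :=
  exists I I' bin bout, exchange I I' bin bout T T'.

Lemma recolor (g : nat -> X) I bin bout vals :
  uniq (I ++ bin) -> uniq (I ++ bout) -> size vals = size I ->
  exists g', [/\ map g' I = vals, map g' (bin ++ bout) = map g (bin ++ bout)
                & {in [predC I], g' =1 g}].
Proof.
rewrite !cat_uniq => /and3P[uI /hasPn bI _] /and3P[_ /hasPn bI' _] sz.
pose g' x := if x \in I then nth (g x) vals (index x I) else g x.
have off : {in [predC I], g' =1 g} by move=> x /negPf xI; rewrite /g' xI.
exists g'; split=> //.
  apply: (@eq_from_nth _ (g 0)) => [|i]; rewrite size_map ?sz // => iI.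
  rewrite (nth_map 0) // /g' mem_nth // index_uniq //.
  by apply: set_nth_default; rewrite sz.
by apply/eq_in_map => x; rewrite mem_cat => /orP[/bI|/bI'] xI; apply: off.
Qed.

(** Recoloring the inside of the disk maps the colorings with [T] to those with
    [T'] and preserves the colors on the boundary, which determine the colors
    inside [T]; hence no two colorings are mapped to the same one. *)
Lemma plug_ncol_le I J bin bout T T' K :
  uniq (I ++ bin) -> uniq (I ++ bout) ->
  {in I, forall x, x \notin in_labels K.1 ++ out_labels K.1 ++ K.2} ->
  {subset bout <= bin ++ in_labels K.1} ->
  perm_eq (tangle_ins T) (J ++ bin) -> {subset bin <= tangle_ins T'} ->
  recolorable I (bin ++ bout) T T' -> rigid J (bin ++ bout) T ->
  plug_ncol T K <= plug_ncol T' K.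
Proof.
move=> uin uout KI boutP Tin T'in TT' Trig.
have offI x : x \in in_labels K.1 ++ out_labels K.1 ++ K.2 -> x \in [predC I].
  by move=> xK; rewrite inE; apply: contraL xK; apply: KI.
apply: (@leq_ncol _ _ _ _ (fun g g' => {in [predC I], g' =1 g})).
  move=> g /andP[gT gK]; have [vals sz sg] := TT' g gT.
  have [g' [gI gB gg']] := recolor g uin uout sz; exists g' => //.
  rewrite sg // (@eq_in_colors _ _ g) // => x; rewrite mem_cat => xK.
  by apply/gg'/offI; rewrite !mem_cat; case/orP: xK => ->; rewrite ?orbT.
move=> g g' h h' /andP[gT _] /andP[hT _] gg' hh' e.
have eL : {in [predC I], forall x,
    x \in tangle_ins T' ++ labels K -> g x = h x}.
  by move=> x xI xL; rewrite -gg' // -hh' // e.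
have bI : {in bin ++ bout, forall x, x \in [predC I]}.
  move=> x; rewrite mem_cat inE; move: uin uout; rewrite !cat_uniq.
  by move=> /and3P[_ /hasPn h1 _] /and3P[_ /hasPn h2 _] /orP[/h1|/h2].
have eB : {in bin ++ bout, g =1 h}.
  move=> x xB; apply: eL; first exact: bI.
  have : x \in bin ++ in_labels K.1.
    by move: xB; rewrite mem_cat => /orP[xb|/boutP//]; rewrite mem_cat xb.
  rewrite mem_cat => /orP[/T'in xT|xK]; first by rewrite mem_cat xT.
  by rewrite mem_cat [x \in labels K]mem_cat xK orbT.
have /eq_in_map eJ : map g J = map h J by apply: Trig => //; apply/eq_in_map.
move=> x; rewrite mem_cat => /orP[|xK]; last first.
  apply: eL; last by rewrite mem_cat xK orbT.
  by apply: offI; move: xK; rewrite !mem_cat => /orP[->|->]; rewrite ?orbT.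
rewrite (perm_mem Tin) mem_cat => /orP[/eJ//|xb].
by apply: eB; rewrite mem_cat xb.
Qed.

Lemma exchange_plug_ncol I I' bin bout T T' K :
  uniq (I ++ bin) -> uniq (I ++ bout) ->
  {in I, forall x, x \notin in_labels K.1 ++ out_labels K.1 ++ K.2} ->
  {subset bout <= bin ++ in_labels K.1} ->
  exchange I I' bin bout T T' -> plug_ncol T K = plug_ncol T' K.
Proof.
move=> uin uout KI boutP.
move=> [_ _ /andP[Tin _] /andP[T'in _] TT' T'T Trig T'rig].
have sub J U : perm_eq (tangle_ins U) (J ++ bin) ->
    {subset bin <= tangle_ins U}.
  by move=> p x xb; rewrite (perm_mem p) mem_cat xb orbT.
apply/eqP; rewrite eqn_leq.
rewrite (plug_ncol_le uin uout KI boutP Tin (sub _ _ T'in) TT' Trig).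
by rewrite (plug_ncol_le uin uout KI boutP T'in (sub _ _ Tin) T'T T'rig).
Qed.

(** * The moves exchange such tangles *)

Definition strand_kind (over : bool) : kind := if over then pos else neg.

Lemma strand_kind_classical over : strand_kind over != flat.
Proof. by case: over. Qed.

Lemma colors_crossing g k a b c d :
  colors g (Crossing k a b c d) = fits k (g a) (g b) (g c) (g d).
Proof. by []. Qed.

Lemma colors_cross_lr g over ti to si so :
  colors g (cross_lr over ti to si so) =
  fits (strand_kind over) (g ti) (g si) (g so) (g to).
Proof. by case: over. Qed.

Lemma colors_cross_rl g over ti to si so :
  colors g (cross_rl over ti to si so) =
  fits (strand_kind over) (g to) (g so) (g si) (g ti).
Proof. by rewrite -fits_opp ?strand_kind_classical //; case: over. Qed.

Definition colorsE := (colors_cross_lr, colors_cross_rl, colors_crossing).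

Lemma sat1 g c : sat g ([:: c], [::]) = colors g c.
Proof. by rewrite /sat /= !andbT. Qed.

Lemma sat2 g c1 c2 : sat g ([:: c1; c2], [::]) = colors g c1 && colors g c2.
Proof. by rewrite /sat /= !andbT. Qed.

Lemma sat3 g c1 c2 c3 : sat g ([:: c1; c2; c3], [::]) =
  [&& colors g c1, colors g c2 & colors g c3].
Proof. by rewrite /sat /= !andbT. Qed.

Lemma sat_strands g js : sat g ([::], js) = respects g js.
Proof. by []. Qed.

Ltac list_ends := apply/andP; split; apply/permP => p; rewrite /=;
  repeat match goal with |- context [nat_of_bool ?b] =>
    move: (nat_of_bool b) => ? end; clear; lia.

Lemma kink_exchangeable k T T' : k != flat \/ pI_adequate Q ->
  kink k T T' -> exchangeable T T'.
Proof.
move=> kQ; case=> {T T'} a b l; exists [:: l], [::], [:: a], [:: b].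
- split=> //; try by list_ends.
  - move=> g; rewrite sat1 colorsE => /fitsP[eb ea]; exists [:: g l] => //.
    move=> g' _ [ea' eb']; rewrite sat_strands /= ea' eb' ea eb diag_op //.
    by rewrite eqxx.
  - move=> g; rewrite sat_strands /= andbT => /eqP eab.
    have [c ec] := kink_fits (g a) kQ; exists [:: c] => // g' [el] [ea eb].
    by rewrite sat1 colorsE el ea eb -eab; apply/fitsP; rewrite -diag_op.
  - move=> g h; rewrite !sat1 !colorsE => /fitsP[eb ea] /fitsP[eb' ea'].
    case=> ga gb; have [el _] : g l = h l /\ g l = h l; last by rewrite /= el.
    by apply: (@side_inj k); rewrite -?ea -?ea' -?eb -?eb'.
- split=> //; try by list_ends.
  - move=> g; rewrite sat1 colorsE => /fitsP[et eb]; exists [:: g l] => //.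
    move=> g' _ [ea' eb']; rewrite sat_strands /= ea' eb'.
    (* Some [c] has [g l = tlop k c c = blop k c c], so that [g a] and [g b]
       both equal [c] by invertibility of [S] or [S']. *)
    have [c ec] := kink_fits (g l) kQ.
    have [-> ->] : g a = c /\ g b = c; last by rewrite eqxx.
    by apply: (@side_inj k); rewrite -?et -?eb // ec diag_op.
  - move=> g; rewrite sat_strands /= andbT => /eqP eab.
    exists [:: tlop k (g a) (g a)] => // g' [el] [ea eb].
    rewrite sat1 colorsE el ea eb -eab {1}diag_op //; exact: fits_intro.
  - move=> g h; rewrite !sat1 !colorsE => /fitsP[eb _] /fitsP[eb' _].
    by case=> ga gb; rewrite /= eb eb' ga gb.
Qed.

(** Read upside down, the second crossing of a bigon obeys the same rule as the
    first ([fits_opp]), and the two share two adjacent ends: hence their other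
    ends agree. *)
Lemma bigon_exchangeable k T T' : k != flat -> bigon k T T' ->
  exchangeable T T'.
Proof.
move=> kN; case=> {T T'} a b c d m n;
  exists [:: m; n], [::], [:: a; c], [:: b; d].
- split=> //; try by list_ends.
  - move=> g; rewrite sat2 !colorsE fits_opp // => /andP[c1 c2].
    exists [:: g m; g n] => // g' _ [ea ec eb ed].
    rewrite sat_strands /= ea ec eb ed.
    by have [-> ->] := fits_top c1 c2; rewrite !eqxx.
  - move=> g; rewrite sat_strands /= andbT => /andP[/eqP eab /eqP ecd].
    have [y ey] := blop_onto k (g c) (g a).
    exists [:: tlop k (g c) y; y] => // g' [em en] [ea ec eb ed].
    rewrite sat2 !colorsE fits_opp //.
    by rewrite em en ea ec eb ed -eab -ecd andbb ey fits_intro.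
  - move=> g h; rewrite !sat2 !colorsE => /andP[c1 _] /andP[c2 _].
    case=> ga gc _ _; move: c1; rewrite ga gc => c1.
    by have [em en] := fits_bottom c1 c2; rewrite /= em en.
- split=> //; try by list_ends.
  - move=> g; rewrite sat2 !colorsE fits_opp // => /andP[c1 c2].
    exists [:: g m; g n] => // g' _ [ea ec eb ed].
    rewrite sat_strands /= ea ec eb ed.
    by have [-> ->] := fits_left c1 c2; rewrite !eqxx.
  - move=> g; rewrite sat_strands /= andbT => /andP[/eqP eab /eqP ecd].
    exists [:: tlop k (g a) (g c); blop k (g c) (g a)] => //.
    move=> g' [em en] [ea ec eb ed]; rewrite sat2 !colorsE fits_opp //.
    by rewrite em en ea ec eb ed -eab -ecd andbb fits_intro.
  - move=> g h; rewrite !sat2 !colorsE => /andP[c1 _] /andP[c2 _].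
    case=> ga _ _ gd; move: c1; rewrite ga gd => c1.
    by have [en em] := fits_right c1 c2; rewrite /= em en.
- split=> //; try by list_ends.
  - move=> g; rewrite sat2 !colorsE fits_opp // => /andP[c1 c2].
    exists [:: g m; g n] => // g' _ [ea ec eb ed].
    rewrite sat_strands /= ea ec eb ed.
    by have [-> ->] := fits_right c1 c2; rewrite !eqxx.
  - move=> g; rewrite sat_strands /= andbT => /andP[/eqP eab /eqP ecd].
    have [x [y [ea' ec']]] := side_onto k (g a) (g c).
    exists [:: y; x] => // g' [em en] [ea ec eb ed].
    rewrite sat2 !colorsE fits_opp //.
    by rewrite em en ea ec eb ed -eab -ecd andbb ea' ec' fits_intro.
  - move=> g h; rewrite !sat2 !colorsE => /andP[c1 _] /andP[c2 _].
    case=> ga _ _ gd; move: c1; rewrite ga gd => c1.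
    by have [en em] := fits_left c1 c2; rewrite /= em en.
Qed.

Lemma psII_exchangeable k a b c d m n : k != flat ->
  exchangeable ([:: Crossing flat a c m n; Crossing k m n b d], [::])
               ([:: Crossing k a c m n; Crossing flat m n b d], [::]).
Proof.
move=> kN; exists [:: m; n], [:: m; n], [:: a; c], [:: b; d].
split=> //; try by list_ends.
- move=> g; rewrite sat2 !colorsE => /andP[c1 c2].
  have [x [y c12]] := psII_fits_rev kN c1 c2.
  exists [:: x; y] => // g' [em en] [ea ec eb ed].
  by rewrite sat2 !colorsE em en ea ec eb ed.
- move=> g; rewrite sat2 !colorsE => /andP[c1 c2].
  have [x [y c12]] := psII_fits kN c1 c2.
  exists [:: x; y] => // g' [em en] [ea ec eb ed].
  by rewrite sat2 !colorsE em en ea ec eb ed.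
- move=> g h; rewrite !sat2 !colorsE => /andP[c1 _] /andP[c2 _].
  case=> ga gc _ _; move: c1; rewrite ga gc => c1.
  by have [em en] := fits_bottom c1 c2; rewrite /= em en.
- move=> g h; rewrite !sat2 !colorsE => /andP[c1 _] /andP[c2 _].
  case=> ga gc _ _; move: c1; rewrite ga gc => c1.
  by have [em en] := fits_bottom c1 c2; rewrite /= em en.
Qed.

(** Each side of a slide consists of three faces of a cube around a corner, and
    the other side of the three opposite faces. The three colors inside are
    those of the edges at that corner; two of them are read off the first face
    used for rigidity and the third one off the second. *)
Lemma slide_exchangeable k over T T' : slide k over T T' -> exchangeable T T'.
Proof.
have sN := strand_kind_classical over; set s := strand_kind over in sN.
case=> {T T'} a1 a2 a3 b1 b2 b3 u v w;
  exists [:: u; v; w], [:: u; v; w], [:: a1; a2; a3], [:: b1; b2; b3];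
  split=> //; try by list_ends.
- move=> g; rewrite sat3 !colorsE => /and3P[c1 c2 kk].
  have [N [f1 [f2 [/andP[k1 k2] /andP[c1' c2'] /andP[d2' d1']]]]] :=
    cube_k'_e2_e1 sN kk c2 c1.
  exists [:: f1; f2; N] => // g' [eu ev ew] [ea1 ea2 ea3 eb1 eb2 eb3].
  by rewrite sat3 !colorsE eu ev ew ea1 ea2 ea3 eb1 eb2 eb3; apply/and3P.
- move=> g; rewrite sat3 !colorsE => /and3P[kk d2 d1].
  have [S [e1' [e2' [/andP[k1 k2] /andP[c1' c2'] /andP[d2' d1']]]]] :=
    cube_k_f1_f2 sN kk d1 d2.
  exists [:: e1'; e2'; S] => // g' [eu ev ew] [ea1 ea2 ea3 eb1 eb2 eb3].
  by rewrite sat3 !colorsE eu ev ew ea1 ea2 ea3 eb1 eb2 eb3; apply/and3P.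
- move=> g h sg sh [ea1 ea2 ea3 eb1 eb2 eb3]; move: sg sh.
  rewrite !sat3 !colorsE ea1 ea2 ea3 eb1 eb2 eb3 /=.
  move=> /and3P[_ c2 kk] /and3P[_ c2h kkh].
  have [eu ev] := fits_top kk kkh.
  by have [ew _] := fits_right c2 c2h; rewrite eu ev ew.
- move=> g h sg sh [ea1 ea2 ea3 eb1 eb2 eb3]; move: sg sh.
  rewrite !sat3 !colorsE ea1 ea2 ea3 eb1 eb2 eb3 /=.
  move=> /and3P[kk _ d1] /and3P[kkh _ d1h].
  have [ev eu] := fits_bottom kk kkh.
  by have [ew _] := fits_top d1 d1h; rewrite eu ev ew.
- move=> g; rewrite sat3 !colorsE => /and3P[c2 c1 kk].
  have [N [f1' [f2' [/andP[k1 k2] /andP[c1' c2'] /andP[d2' d1']]]]] :=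
    cube_k_e2_e1 sN kk c2 c1.
  exists [:: f1'; f2'; N] => // g' [eu ev ew] [ea1 ea2 ea3 eb1 eb2 eb3].
  by rewrite sat3 !colorsE eu ev ew ea1 ea2 ea3 eb1 eb2 eb3; apply/and3P.
- move=> g; rewrite sat3 !colorsE => /and3P[kk d1 d2].
  have [S [e1 [e2 [/andP[k1 k2] /andP[c1' c2'] /andP[d2' d1']]]]] :=
    cube_k'_f1_f2 sN kk d1 d2.
  exists [:: e1; e2; S] => // g' [eu ev ew] [ea1 ea2 ea3 eb1 eb2 eb3].
  by rewrite sat3 !colorsE eu ev ew ea1 ea2 ea3 eb1 eb2 eb3; apply/and3P.
- move=> g h sg sh [ea1 ea2 ea3 eb1 eb2 eb3]; move: sg sh.
  rewrite !sat3 !colorsE ea1 ea2 ea3 eb1 eb2 eb3 /=.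
  move=> /and3P[c2 _ kk] /and3P[c2h _ kkh].
  have [eu ev] := fits_top kk kkh.
  by have [ew _] := fits_top c2 c2h; rewrite eu ev ew.
- move=> g h sg sh [ea1 ea2 ea3 eb1 eb2 eb3]; move: sg sh.
  rewrite !sat3 !colorsE ea1 ea2 ea3 eb1 eb2 eb3 /=.
  move=> /and3P[kk d1 _] /and3P[kkh d1h _].
  have [ev eu] := fits_bottom kk kkh.
  by have [ew _] := fits_right d1 d1h; rewrite eu ev ew.
- move=> g; rewrite sat3 !colorsE => /and3P[c1 d2 kk].
  have [E [e2' [f1' [/andP[k1 k2] /andP[c1' c2'] /andP[d2' d1']]]]] :=
    cube_k_e1_f2 sN kk c1 d2.
  exists [:: f1'; e2'; E] => // g' [eu ev ew] [ea1 ea2 ea3 eb1 eb2 eb3].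
  by rewrite sat3 !colorsE eu ev ew ea1 ea2 ea3 eb1 eb2 eb3; apply/and3P.
- move=> g; rewrite sat3 !colorsE => /and3P[c2 d1 kk].
  have [W [e1 [f2 [/andP[k1 k2] /andP[c1' c2'] /andP[d2' d1']]]]] :=
    cube_k'_e2_f1 sN kk c2 d1.
  exists [:: e1; f2; W] => // g' [eu ev ew] [ea1 ea2 ea3 eb1 eb2 eb3].
  by rewrite sat3 !colorsE eu ev ew ea1 ea2 ea3 eb1 eb2 eb3; apply/and3P.
- move=> g h sg sh [ea1 ea2 ea3 eb1 eb2 eb3]; move: sg sh.
  rewrite !sat3 !colorsE ea1 ea2 ea3 eb1 eb2 eb3 /=.
  move=> /and3P[c1 _ kk] /and3P[c1h _ kkh].
  have [eu ev] := fits_right kk kkh.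
  by have [ew _] := fits_top c1 c1h; rewrite eu ev ew.
- move=> g h sg sh [ea1 ea2 ea3 eb1 eb2 eb3]; move: sg sh.
  rewrite !sat3 !colorsE ea1 ea2 ea3 eb1 eb2 eb3 /=.
  move=> /and3P[c2 _ kk] /and3P[c2h _ kkh].
  have [ev eu] := fits_left kk kkh.
  by have [_ ew] := fits_bottom c2 c2h; rewrite eu ev ew.
- move=> g; rewrite sat3 !colorsE => /and3P[d2 c1 kk].
  have [E [e2 [f1 [/andP[k1 k2] /andP[c1' c2'] /andP[d2' d1']]]]] :=
    cube_k'_e1_f2 sN kk c1 d2.
  exists [:: f1; e2; E] => // g' [eu ev ew] [ea1 ea2 ea3 eb1 eb2 eb3].
  by rewrite sat3 !colorsE eu ev ew ea1 ea2 ea3 eb1 eb2 eb3; apply/and3P.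
- move=> g; rewrite sat3 !colorsE => /and3P[d1 c2 kk].
  have [W [e1' [f2' [/andP[k1 k2] /andP[c1' c2'] /andP[d2' d1']]]]] :=
    cube_k_e2_f1 sN kk c2 d1.
  exists [:: e1'; f2'; W] => // g' [eu ev ew] [ea1 ea2 ea3 eb1 eb2 eb3].
  by rewrite sat3 !colorsE eu ev ew ea1 ea2 ea3 eb1 eb2 eb3; apply/and3P.
- move=> g h sg sh [ea1 ea2 ea3 eb1 eb2 eb3]; move: sg sh.
  rewrite !sat3 !colorsE ea1 ea2 ea3 eb1 eb2 eb3 /=.
  move=> /and3P[_ c1 kk] /and3P[_ c1h kkh].
  have [eu ev] := fits_right kk kkh.
  by have [ew _] := fits_right c1 c1h; rewrite eu ev ew.
- move=> g h sg sh [ea1 ea2 ea3 eb1 eb2 eb3]; move: sg sh.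
  rewrite !sat3 !colorsE ea1 ea2 ea3 eb1 eb2 eb3 /=.
  move=> /and3P[_ c2 kk] /and3P[_ c2h kkh].
  have [ev eu] := fits_left kk kkh.
  by have [_ ew] := fits_left c2 c2h; rewrite eu ev ew.
Qed.

Lemma singular_exchangeable T T' : singular_move T T' -> exchangeable T T'.
Proof.
case=> {T T'}.
- by move=> k T T' kN; apply: kink_exchangeable; left.
- by move=> k T T'; apply: bigon_exchangeable.
- by move=> k over T T' _; apply: slide_exchangeable.
- by move=> k a b c d m n; apply: psII_exchangeable.
- by move=> T T'; apply: slide_exchangeable.
- by move=> T T'; apply: slide_exchangeable.
Qed.

Lemma pseudo_exchangeable T T' :
  pI_adequate Q -> pseudo_move T T' -> exchangeable T T'.
Proof.
move=> pI; case=> U U'; first exact: singular_exchangeable.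
by apply: kink_exchangeable; right.
Qed.

(** * The counting invariant *)

Lemma diagram_well_formed (D : diagram) : well_formed D.
Proof. by case: D => D /= /andP[]. Qed.

Lemma reidemeister_ncolorings (move : tangle -> tangle -> Prop)
    (D D' : diagram) :
  (forall T T', move T T' -> exchangeable T T') ->
  reidemeister move D D' -> ncolorings Q D = ncolorings Q D'.
Proof.
move=> mv [T [T' [K [/mv[I [I' [bin [bout ex]]]] iso iso']]]].
have [T2 bin0 /andP[pin pout] /andP[pin' pout'] _ _ _ _] := ex.
(* Well-formedness of the diagram containing [T] separates the labels inside
   the disk from those on its boundary and outside. *)
have := isotopic_well_formed iso (diagram_well_formed D).
have -> : plug T K = (T.1 ++ K.1, K.2) by rewrite /plug T2.
have tinT : tangle_ins T = in_labels T.1 by rewrite /tangle_ins T2 cats0.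
have toutT : tangle_outs T = out_labels T.1 by rewrite /tangle_outs T2 cats0.
rewrite /well_formed /labels /= in_labels_cat out_labels_cat -tinT -toutT.
rewrite -catA => /andP[uTK balT].
have uTK' : uniq (tangle_outs T ++ out_labels K.1).
  rewrite -(perm_uniq balT); move: uTK.
  by rewrite catA cat_uniq => /and3P[].
have [uT KT] : uniq (tangle_ins T) /\
    {in tangle_ins T, forall x, x \notin in_labels K.1 ++ K.2}.
  move: uTK; rewrite cat_uniq => /and3P[-> /hasPn KT _]; split=> // x xT.
  by apply: contraL xT => /KT.
have [uT' KT'] : uniq (tangle_outs T) /\
    {in tangle_outs T, forall x, x \notin out_labels K.1}.
  move: uTK'; rewrite cat_uniq => /and3P[-> /hasPn KT' _]; split=> // x xT.
  by apply: contraL xT => /KT'.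
(* Cancelling the labels inside, strands also continue across the boundary
   after the exchange. *)
have balB : perm_eq (bin ++ in_labels K.1) (bout ++ out_labels K.1).
  rewrite -(perm_cat2l I) !catA -(permPl (perm_cat pin (perm_refl _))).
  by rewrite -(permPr (perm_cat pout (perm_refl _))).
have eqTT' : plug_ncol T K = plug_ncol T' K.
  apply: (exchange_plug_ncol _ _ _ _ ex).
  - by rewrite -(perm_uniq pin).
  - by rewrite -(perm_uniq pout).
  - move=> x xI.
    have xT : x \in tangle_ins T by rewrite (perm_mem pin) mem_cat xI.
    have xT' : x \in tangle_outs T by rewrite (perm_mem pout) mem_cat xI.
    move: (KT x xT) (KT' x xT'); rewrite !mem_cat !negb_or.
    by move=> /andP[-> ->] ->.
  - by move=> x xb; rewrite (perm_mem balB) mem_cat xb.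
have ncol_plug (E : diagram) U J : isotopic E (plug U K) ->
    perm_eq (tangle_ins U) (J ++ bin) -> perm_eq (tangle_outs U) (J ++ bout) ->
    ncolorings Q E = plug_ncol U K.
  move=> isoE p p'; have wE := diagram_well_formed E.
  have balU : {subset tangle_outs U ++ out_labels K.1 <=
                      tangle_ins U ++ in_labels K.1}.
    move=> x; rewrite (perm_mem (perm_cat p (perm_refl _))).
    rewrite (perm_mem (perm_cat p' (perm_refl _))) -!catA !(mem_cat _ J).
    by rewrite (perm_mem balB).
  rewrite (isotopic_ncolorings wE isoE) ncolorings_code.
  - exact: plug_code_ncol.
  - apply: plug_labels_neq0 => //; rewrite -size_eq0 (perm_size p) size_cat.
    by rewrite addn_eq0 negb_and !size_eq0 bin0 orbT.
  - have /andP[_ wU] := isotopic_well_formed isoE wE.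
    by move=> x; rewrite -(perm_mem wU) mem_cat => ->.
by rewrite (ncol_plug D T I) // (ncol_plug D' T' I') // eqTT'.
Qed.

Lemma ncolorings_link (move : tangle -> tangle -> Prop) :
  (forall D D' : diagram, reidemeister move D D' ->
     ncolorings Q D = ncolorings Q D') ->
  exists! Phi : link move -> nat,
    forall D : diagram, Phi (link_of move D) = ncolorings Q D.
Proof.
move=> inv.
have eqv (D D' : diagram) :
    equivalent move D D' -> ncolorings Q D = ncolorings Q D'.
  elim=> {D D'} [D D' iso|D D'|D D' _ ->|D D' D'' _ -> _ ->] //.
  - exact: isotopic_ncolorings (diagram_well_formed D) iso.
  - exact: inv.
pose rep (L : link move) : diagram :=
  repr (L : {eq_quot equivalent_rel move}%qT).
have repK L : link_of move (rep L) = L by apply: reprK.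
exists (fun L => ncolorings Q (rep L)); split=> [D|Phi PhiE].
  by apply/eqv/asboolP; apply/(@eqmodP _ (equivalent_rel move)); apply: repK.
by apply: funext => L; rewrite -PhiE repK.
Qed.

End Colorings.

Theorem theorem3 (X : finType) (Q : psyquandle X) :
  ((forall D D' : diagram, reidemeister singular_move D D' ->
      ncolorings Q D = ncolorings Q D')
   /\ (exists! Phi : singular_link -> nat,
        forall D : diagram, Phi (link_of singular_move D) = ncolorings Q D))
  /\
  (pI_adequate Q ->
   (forall D D' : diagram, reidemeister pseudo_move D D' ->
      ncolorings Q D = ncolorings Q D')
   /\ (exists! Phi : pseudolink -> nat,
        forall D : diagram, Phi (link_of pseudo_move D) = ncolorings Q D)).
Proof.
have sing (D D' : diagram) : reidemeister singular_move D D' ->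
    ncolorings Q D = ncolorings Q D'.
  by apply: reidemeister_ncolorings; apply: singular_exchangeable.
split=> [|pI]; first by split=> //; apply: ncolorings_link.
have pseu (D D' : diagram) : reidemeister pseudo_move D D' ->
    ncolorings Q D = ncolorings Q D'.
  by apply: reidemeister_ncolorings => T T'; apply: pseudo_exchangeable.
by split=> //; apply: ncolorings_link.
Qed.
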